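(* Let $\phi:\mathbb{R}^d\to\mathbb{R}$ be bounded below, twice continuously differentiable, with $M$-Lipschitz continuous gradient ($M>0$), and $m$-strongly convex with $0<m\le M$. Let $f:\mathbb{R}^d\to\mathbb{R}$, $g:\mathbb{R}^d\to\mathbb{R}^d$ and constants $\epsilon_f,\epsilon_g\ge 0$ satisfy $|f(x)-\phi(x)|\le\epsilon_f$ and $\|g(x)-\nabla\phi(x)\|\le\epsilon_g$ for all $x\in\mathbb{R}^d$. Let $\{x_k\}$ be generated by the BFGS method with errors (described in the context) with constants $0<c_1<c_2<1$ and lengthening parameter $l>0$ satisfying $l>2\epsilon_g/m$. Fix $q\in(0,1)$, and let $\beta_1$, $A$, $B$ be the constants defined in the context. Let $$\mathcal{N}_1=\left\{x\in\mathbb{R}^d \;:\; \|\nabla\phi(x)\|\le\max\left\{A\frac{\sqrt{M\epsilon_f}}{\beta_1},\ B\frac{\epsilon_g}{\beta_1}\right\}\right\},$$ let $K=\min\{k\in\mathbb{N}: x_k\in\mathcal{N}_1\}$ (with $K=+\infty$ if no iterate lies in $\mathcal{N}_1$), and let $$\widehat\phi=\max_{x\in\mathcal{N}_1}\phi(x),\qquad \mathcal{N}_2=\{x\in\mathbb{R}^d:\ \phi(x)\le\widehat\phi+2\epsilon_f\}.$$ Then $x_k\in\mathcal{N}_2$ for all $k\ge K$.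
   Context: $\|\cdot\|$ is the Euclidean norm; $\mathbb{N}=\{0,1,2,\dots\}$. BFGS method with errors. Inputs: $f$, $g$, constants $0<c_1<c_2<1$, lengthening parameter $l>0$, starting point $x_0\in\mathbb{R}^d$, symmetric positive definite $H_0\in\mathbb{R}^{d\times d}$. For $k=0,1,2,\dots$: (1) $p_k=-H_kg(x_k)$. (2) Line search: attempt to find $\alpha>0$ such that $f(x_k+\alpha p_k)\le f(x_k)+c_1\alpha p_k^Tg(x_k)$ and $p_k^Tg(x_k+\alpha p_k)\ge c_2p_k^Tg(x_k)$. If the attempt succeeds, $\alpha_k$ is the $\alpha$ found; otherwise $\alpha_k=0$. (3) If $\|\alpha_kp_k\|\ge l$, set $s_k=\alpha_kp_k$; otherwise set $s_k=l\,p_k/\|p_k\|$. In both cases $y_k=g(x_k+s_k)-g(x_k)$. (4) $H_{k+1}=(I-\rho_ks_ky_k^T)H_k(I-\rho_ky_ks_k^T)+\rho_ks_ks_k^T$ with $\rho_k=1/(s_k^Ty_k)$. (5) $x_{k+1}=x_k+\alpha_kp_k$. It is understood that $g(x_k)\ne0$ for all $k$, so that all steps are defined. Constants: $B_0=H_0^{-1}$, $\widehat m=m-2\epsilon_g/l$, $\widehat M=M+2\epsilon_g/l$, $$\beta_0=\frac{1}{1-q}\left[\mathrm{tr}(B_0)-\log\det(B_0)+\widehat M-1-\log\widehat m\right],\qquad \beta_1=e^{-\beta_0/2}\in(0,1),$$ $$A=\max\left\{\frac{16\sqrt2}{\sqrt{(c_2-c_1)(4-c_1-3c_2)}},\ \frac{8}{\sqrt{c_1(1-c_2)}}\right\},\qquad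 B=\max\left\{\frac{8}{1-c_2},\ \frac{8(1+c_1)}{c_2-c_1}+6\right\}.$$ *)

(* Defs.v *)
From HB Require Import structures.
From mathcomp Require Import all_boot all_order all_algebra.
From mathcomp Require Import all_classical all_reals all_analysis.

Set Implicit Arguments.
Unset Strict Implicit.
Unset Printing Implicit Defensive.

Import Order.TTheory GRing.Theory Num.Theory.
Import numFieldNormedType.Exports.

Local Open Scope classical_set_scope.
Local Open Scope ring_scope.

Section Euclidean.
Context {R : realType} {d : nat}.
Implicit Types (u v : 'cV[R]_d) (phi : 'cV[R]_d -> R) (H : 'M[R]_d).

Definition dot u v : R := (u^T *m v) 0 0.

(* The library norm `|u| on matrices is the sup norm. It induces the same
   topology, so library continuity and differentiability are unaffected. *)
Definition enorm u : R := Num.sqrt (dot u u).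

Definition spd H : Prop :=
  H^T = H /\ forall v, v != 0 -> 0 < dot v (H *m v).

Definition gradient phi (x : 'cV[R]_d) : 'cV[R]_d :=
  \col_i 'D_(delta_mx i 0) phi x.

Definition twice_cont_diff phi : Prop :=
  [/\ forall x, differentiable phi x,
      forall x, differentiable (gradient phi) x
    & forall v, continuous (fun x => 'D_v (gradient phi) x)].

Definition lipschitz_gradient (M : R) phi : Prop :=
  forall x y, enorm (gradient phi x - gradient phi y) <= M * enorm (x - y).

Definition strongly_convex (m : R) phi : Prop :=
  forall x y (t : R), 0 <= t <= 1 ->
    phi (t *: x + (1 - t) *: y) <=
      t * phi x + (1 - t) * phi y - m / 2 * t * (1 - t) * enorm (x - y) ^+ 2.

Definition bounded_below phi : Prop := exists c : R, forall x, c <= phi x.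

End Euclidean.

Section BFGS.
Context {R : realType} {d : nat}.
Variables (f : 'cV[R]_d -> R) (g : 'cV[R]_d -> 'cV[R]_d).
Variables (c1 c2 l : R).

Definition armijo_wolfe (x p : 'cV[R]_d) (a : R) : Prop :=
  f (x + a *: p) <= f x + c1 * a * dot p (g x) /\
  c2 * dot p (g x) <= dot p (g (x + a *: p)).

(* The search procedure itself is unspecified: it either returns an acceptable
   step or fails, and failure does not presuppose that no such step exists. *)
Definition line_search_result (x p : 'cV[R]_d) (a : R) : Prop :=
  (0 < a /\ armijo_wolfe x p a) \/ a = 0.

Definition lengthened_step (p : 'cV[R]_d) (a : R) : 'cV[R]_d :=
  if l <= enorm (a *: p) then a *: p else (l / enorm p) *: p.

Definition bfgs_update (H : 'M[R]_d) (s y : 'cV[R]_d) : 'M[R]_d :=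
  let rho := 1 / dot s y in
  (1%:M - rho *: (s *m y^T)) *m H *m (1%:M - rho *: (y *m s^T))
  + rho *: (s *m s^T).

Record bfgs_with_errors (x0 : 'cV[R]_d) (H0 : 'M[R]_d)
    (x p s y : nat -> 'cV[R]_d) (H : nat -> 'M[R]_d) (alpha : nat -> R)
    : Prop := {
  bfgs_x0 : x 0%N = x0;
  bfgs_H0 : H 0%N = H0;
  bfgs_g_neq0 : forall k, g (x k) != 0;
  bfgs_p : forall k, p k = - (H k *m g (x k));
  bfgs_alpha : forall k, line_search_result (x k) (p k) (alpha k);
  bfgs_s : forall k, s k = lengthened_step (p k) (alpha k);
  bfgs_y : forall k, y k = g (x k + s k) - g (x k);
  bfgs_H : forall k, H k.+1 = bfgs_update (H k) (s k) (y k);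
  bfgs_x : forall k, x k.+1 = x k + alpha k *: p k }.

End BFGS.

Section Constants.
Context {R : realType} {d : nat}.

Definition beta0 (m M eps_g l q : R) (H0 : 'M[R]_d) : R :=
  let B0 := invmx H0 in
  let m_hat := m - 2 * eps_g / l in
  let M_hat := M + 2 * eps_g / l in
  1 / (1 - q) * (\tr B0 - ln (\det B0) + M_hat - 1 - ln m_hat).

Definition beta1 (m M eps_g l q : R) (H0 : 'M[R]_d) : R :=
  expR (- beta0 m M eps_g l q H0 / 2).

Definition constA (c1 c2 : R) : R :=
  Num.max (16 * Num.sqrt 2 / Num.sqrt ((c2 - c1) * (4 - c1 - 3 * c2)))
          (8 / Num.sqrt (c1 * (1 - c2))).

Definition constB (c1 c2 : R) : R :=
  Num.max (8 / (1 - c2)) (8 * (1 + c1) / (c2 - c1) + 6).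

Definition N1 (phi : 'cV[R]_d -> R) (m M eps_f eps_g c1 c2 l q : R)
    (H0 : 'M[R]_d) : set 'cV[R]_d :=
  let b1 := beta1 m M eps_g l q H0 in
  [set x | enorm (gradient phi x) <=
    Num.max (constA c1 c2 * (Num.sqrt (M * eps_f) / b1))
            (constB c1 c2 * (eps_g / b1))].

Definition N2 (phi : 'cV[R]_d -> R) (phi_hat eps_f : R) : set 'cV[R]_d :=
  [set x | phi x <= phi_hat + 2 * eps_f].

(* An infimum of natural numbers: a minimum, or +oo if S is never entered. *)
Definition first_entry (x : nat -> 'cV[R]_d) (S : set 'cV[R]_d) : \bar R :=
  ereal_inf [set (k%:R)%:E | k in [set k : nat | S (x k)]].

Definition is_max (E : set R) (a : R) : Prop := E a /\ ubound E a.

End Constants.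

(* Main.v *)
(* By strong convexity and the gradient error bound, a step of length at least
   l > 2 eps_g / m has s^T y > 0, so every H_k stays positive definite and every
   p_k is a descent direction for the noisy gradient.  The Armijo condition then
   makes f(x_k) nonincreasing, whence phi(x_k) <= phi(x_K) + 2 eps_f for k >= K.
   The maximum over N_1 exists because strong convexity makes N_1 nonempty
   and bounded. *)

Require Import Defs.
From HB Require Import structures.
From mathcomp Require Import all_boot all_order all_algebra.
From mathcomp Require Import all_classical all_reals all_analysis.

From mathcomp Require Import ring lra.

Set Implicit Arguments.
Unset Strict Implicit.
Unset Printing Implicit Defensive.

Import Order.TTheory GRing.Theory Num.Theory.
Import numFieldNormedType.Exports.

Local Open Scope classical_set_scope.
Local Open Scope ring_scope.

(** * Euclidean inner product, norm and compactness *)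

Section EuclideanTheory.
Context {R : realType} {d : nat}.
Implicit Types (u v w : 'cV[R]_d) (a : R).

Lemma dotE u v : dot u v = \sum_i u i 0 * v i 0.
Proof. by rewrite /dot mxE; apply: eq_bigr => i _; rewrite mxE. Qed.

Lemma dotC u v : dot u v = dot v u.
Proof. by rewrite !dotE; apply: eq_bigr => i _; rewrite mulrC. Qed.

Lemma dotDr u v w : dot u (v + w) = dot u v + dot u w.
Proof. by rewrite /dot mulmxDr mxE. Qed.

Lemma dotZr u a v : dot u (a *: v) = a * dot u v.
Proof. by rewrite /dot -scalemxAr mxE. Qed.

Lemma dotNr u v : dot u (- v) = - dot u v.
Proof. by rewrite /dot mulmxN mxE. Qed.

Lemma dotBr u v w : dot u (v - w) = dot u v - dot u w.
Proof. by rewrite dotDr dotNr. Qed.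

Lemma dotBl u v w : dot (u - v) w = dot u w - dot v w.
Proof. by rewrite dotC dotBr !(dotC w). Qed.

Lemma dotZl a u v : dot (a *: u) v = a * dot u v.
Proof. by rewrite dotC dotZr dotC. Qed.

Lemma dot_ge0 u : 0 <= dot u u.
Proof. by rewrite dotE sumr_ge0// => i _; rewrite -expr2 sqr_ge0. Qed.

Lemma dot_eq0 u : (dot u u == 0) = (u == 0).
Proof.
apply/eqP/eqP => [|->]; last by rewrite /dot mulmx0 mxE.
rewrite dotE => /psumr_eq0P u0; apply/matrixP => i j; rewrite ord1 mxE.
by apply/eqP; rewrite -sqrf_eq0 expr2 u0// => k _; rewrite -expr2 sqr_ge0.
Qed.

Lemma enorm_ge0 u : 0 <= enorm u.
Proof. exact: sqrtr_ge0. Qed.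

Lemma sqr_enorm u : enorm u ^+ 2 = dot u u.
Proof. by rewrite sqr_sqrtr// dot_ge0. Qed.

Lemma enorm_eq0 u : (enorm u == 0) = (u == 0).
Proof. by rewrite -sqrf_eq0 sqr_enorm dot_eq0. Qed.

Lemma enormZ a u : enorm (a *: u) = `|a| * enorm u.
Proof.
by rewrite /enorm dotZl dotZr mulrA -expr2 sqrtrM ?sqr_ge0// sqrtr_sqr.
Qed.

Lemma enormN u : enorm (- u) = enorm u.
Proof. by rewrite -scaleN1r enormZ normrN1 mul1r. Qed.

Lemma norm_coord_le_enorm u i : `|u i 0| <= enorm u.
Proof.
rewrite -sqrtr_sqr ler_wsqrtr// dotE (bigD1 i)//= -expr2 lerDl.
by rewrite sumr_ge0// => j _; rewrite -expr2 sqr_ge0.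
Qed.

(** Cauchy-Schwarz: the squared norm of [dot v v *: u - dot u v *: v] is [dot v v] times the gap
    between the squares of the two sides. *)
Lemma dot_le_enorm u v : dot u v <= enorm u * enorm v.
Proof.
have [->|v0] := eqVneq v 0.
  by rewrite /dot mulmx0 mxE mulr_ge0 ?enorm_ge0.
have vv : 0 < dot v v by rewrite lt_neqAle eq_sym dot_eq0 v0 dot_ge0.
rewrite (le_trans (ler_norm _))// -(@ler_pXn2r _ 2) ?nnegrE//; last first.
  by rewrite mulr_ge0 ?enorm_ge0.
rewrite real_normK ?num_real// exprMn !sqr_enorm -(ler_pM2l vv) -subr_ge0.
have := dot_ge0 (dot v v *: u - dot u v *: v).
rewrite dotBl !dotBr !dotZl !dotZr (dotC v u); set a := dot u u.
by set b := dot u v; set c := dot v v => h; apply: le_trans h _; lra.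
Qed.

Lemma trmx_continuous : continuous (fun v : 'rV[R]_d => v^T).
Proof.
move=> v A /nbhs_ballP[e e0 eA]; apply/nbhs_ballP; exists e => //= w [_ vw].
by apply: eA; split => // i j; rewrite !mxE; exact: vw.
Qed.

(** Heine-Borel: coordinates are bounded by [enorm], so [A] is a closed subset of the transpose of a
    box of row vectors, compact by [rV_compact]. *)
Lemma enorm_bounded_closed_compact (A : set 'cV[R]_d) r :
  closed A -> (forall v, A v -> enorm v <= r) -> compact A.
Proof.
move=> clA Ar.
pose box := [set v : 'rV[R]_d | forall i, v ord0 i \in `[- r, r]].
have cbox : compact box.
  apply: (@rV_compact _ _ (fun=> `[- r, r]%classic)) => _.
  exact: segment_compact.
have : compact ((fun v : 'rV[R]_d => v^T) @` box).
  apply: continuous_compact cbox; apply: continuous_subspaceT.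
  exact: trmx_continuous.
move=> /(subclosed_compact clA); apply=> v /Ar vr.
exists v^T; last by rewrite trmxK.
move=> i; rewrite in_itv/= mxE -ler_norml.
exact: le_trans (norm_coord_le_enorm v i) vr.
Qed.

(** Since [enorm] is not the norm that carries the topology, its continuity is built from
    coordinates: a finite sum of products, then a square root. *)
Lemma closed_enorm_le (T : topologicalType) (F : T -> 'cV[R]_d) r :
  continuous F -> closed [set z | enorm (F z) <= r].
Proof.
move=> cF; suff : continuous (fun z => enorm (F z)).
  by move=> /continuous_closedP/(_ _ (@closed_le _ r)).
move=> z; pose sq t := dot (F t) (F t).
apply: (@continuous_comp _ _ _ sq Num.sqrt); last exact: sqrt_continuous.
have -> : sq = fun t => \sum_i F t i 0 * F t i 0.
  by apply/funext => t; rewrite /sq dotE.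
apply: cvg_big => [|i _]; first exact: add_continuous.
have cFi : F t i 0 @[t --> z] --> F z i 0.
  exact: (continuous_comp (cF z) (@coord_continuous _ _ _ i 0 (F z))).
exact: cvgM.
Qed.

Lemma derive_gradient (phi : 'cV[R]_d -> R) z v :
  differentiable phi z -> 'D_v phi z = dot (gradient phi z) v.
Proof.
move=> dphi; rewrite deriveE// {1}(matrix_sum_delta v) dotE linear_sum/=.
apply: eq_bigr => i _; rewrite big_ord1 linearZ/= mxE -deriveE//.
by rewrite ord1 mulrC.
Qed.

End EuclideanTheory.

(** * First-order consequences of strong convexity *)

Section StronglyConvex.
Context {R : realType} {d : nat}.
Variables (phi : 'cV[R]_d -> R) (m : R).
Hypothesis m_gt0 : 0 < m.
Hypothesis diff_phi : forall z, differentiable phi z.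
Hypothesis convex_phi : strongly_convex m phi.
Implicit Types x y : 'cV[R]_d.

(** Strong convexity on the segment from [x] to [y] bounds the difference quotient with step [h] by
    [phi y - phi x - m / 2 * (1 - h) * N]; then [h] tends to 0 from the right. *)
Lemma strongly_convex_tangent x y :
  phi x + dot (gradient phi x) (y - x) + m / 2 * enorm (y - x) ^+ 2 <= phi y.
Proof.
have : (fun h : R => h^-1 *: (phi (h *: (y - x) + x) - phi x))
    @ 0^'+ --> 'D_(y - x) phi x.
  by apply: cvg_dnbhs_at_right; apply: diff_derivable.
rewrite derive_gradient//.
set N := enorm (y - x) ^+ 2 => lim_slope.
have lim_bound : (fun h : R => phi y - phi x - m / 2 * (1 - h) * N)
    @ 0^'+ --> phi y - phi x - m / 2 * (1 - 0) * N.
  apply: cvg_at_right_filter; apply: cvgB; first exact: cvg_cst.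
  apply: cvgMr_tmp; apply: cvgMl_tmp; apply: cvgB; [exact: cvg_cst|exact: cvg_id].
suff : dot (gradient phi x) (y - x) <= phi y - phi x - m / 2 * (1 - 0) * N by lra.
apply: (ler_cvg_to lim_slope lim_bound); near=> h.
have h0 : 0 < h by near: h; exact: nbhs_right_gt.
have h1 : h <= 1 by near: h; apply: nbhs_right_le.
rewrite -[leLHS]/(h^-1 * _) ler_pdivrMl//.
have := convex_phi y x; move=> /(_ h); rewrite h1 ltW// => /(_ isT).
rewrite -/N (_ : h *: y + _ = h *: (y - x) + x); first by lra.
by rewrite scalerBl scale1r scalerBr addrAC addrA.
Unshelve. all: by end_near. Qed.

(** Sum of the tangent inequalities at [x] and at [y]. *)
Lemma strongly_monotone_gradient x y :
  m * enorm (y - x) ^+ 2 <= dot (y - x) (gradient phi y - gradient phi x).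
Proof.
have := strongly_convex_tangent x y; have := strongly_convex_tangent y x.
rewrite -(opprB y x) enormN dotNr; set w := y - x.
rewrite dotBr !(dotC w); lra.
Qed.

Lemma strongly_convex_critical_point : exists z, gradient phi z = 0.
Proof.
have cphi : continuous phi by move=> z; exact: differentiable_continuous.
pose S := [set z | phi z <= phi 0].
have cS : compact S.
  (* On [S] the tangent inequality at 0 and Cauchy-Schwarz bound [m / 2 * enorm z ^+ 2] by
     [enorm (gradient phi 0) * enorm z]. Dividing by [enorm z] gives the radius; norm zero is
     treated apart. *)
  apply: (@enorm_bounded_closed_compact _ _ _ (2 * enorm (gradient phi 0) / m)).
    by move/continuous_closedP : cphi => /(_ _ (@closed_le _ (phi 0))).
  move=> z; rewrite /S/= => z0.
  have := strongly_convex_tangent 0 z; rewrite subr0.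
  have := dot_le_enorm (- gradient phi 0) z; rewrite enormN dotC dotNr dotC.
  have := enorm_ge0 z; rewrite le_eqVlt => /predU1P[<- _ _|z_gt0 CS T].
    by rewrite !mulr_ge0 ?enorm_ge0// ?invr_ge0 ltW.
  rewrite ler_pdivlMr// -(ler_pM2r z_gt0); lra.
have S0 : S !=set0 by exists 0; rewrite /S/=.
have [z _ zmin] := compact_EVT_min S0 cS (continuous_subspaceT cphi).
exists z; apply/eqP; rewrite -dot_eq0.
have {}zmin y : phi z <= phi y.
  have [y0|/ltW y0] := leP (phi y) (phi 0); first by apply: zmin; rewrite inE.
  by apply: le_trans y0; apply: zmin; rewrite inE /S/=.
(* At the global minimiser all difference quotients are nonnegative for [h > 0]; along the negative
   gradient their limit is minus the squared gradient norm. *)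
rewrite eq_le dot_ge0 andbT -oppr_ge0 -dotNr -derive_gradient//.
have : (fun h : R => h^-1 *: (phi (h *: (- gradient phi z) + z) - phi z))
    @ 0^'+ --> 'D_(- gradient phi z) phi z.
  by apply: cvg_dnbhs_at_right; apply: diff_derivable.
move=> /cvgr_to_ge; apply; near=> h.
by rewrite mulr_ge0 ?subr_ge0// invr_ge0.
Unshelve. all: by end_near. Qed.

End StronglyConvex.

(** * Positive definiteness of the BFGS update *)

Section BFGSUpdate.
Context {R : realType} {d : nat}.
Implicit Types (H : 'M[R]_d) (s y : 'cV[R]_d).

Lemma trmx_rank_one_update s y (rho : R) :
  (1%:M - rho *: (s *m y^T))^T = 1%:M - rho *: (y *m s^T).
Proof. by rewrite linearB/= linearZ/= trmx1 trmx_mul trmxK. Qed.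

(** The update is [E *m H *m E^T] plus a rank-one term, and [w] is [E^T *m v]. *)
Lemma bfgs_update_form H s y v (w := v - (dot s v / dot s y) *: y) :
  dot v (bfgs_update H s y *m v) = dot w (H *m w) + dot s v ^+ 2 / dot s y.
Proof.
set rho := 1 / dot s y; set E := 1%:M - rho *: (s *m y^T).
have ET : E^T = 1%:M - rho *: (y *m s^T) by exact: trmx_rank_one_update.
have mul_outer (u : 'cV[R]_d) : u *m s^T *m v = dot s v *: u.
  by rewrite -mulmxA [s^T *m v]mx11_scalar mul_mx_scalar.
have wE : E^T *m v = w.
  rewrite ET mulmxBl mul1mx -scalemxAl mul_outer scalerA /w /rho.
  by congr (_ - _ *: _); rewrite mul1r mulrC.
rewrite /bfgs_update -/rho -/E -ET mulmxDl dotDr -scalemxAl mul_outer !dotZr.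
rewrite (dotC v s) -{2}wE -wE; congr (_ + _); last by rewrite /rho; ring.
by rewrite /dot trmx_mul trmxK !mulmxA.
Qed.

Lemma bfgs_update_spd H s y : spd H -> 0 < dot s y -> spd (bfgs_update H s y).
Proof.
move=> [HT H_gt0] sy; split.
  rewrite /bfgs_update linearD/= !trmx_mul HT !trmx_rank_one_update mulmxA.
  by congr (_ + _); rewrite linearZ/= trmx_mul trmxK.
move=> v v0; rewrite bfgs_update_form.
(* The two terms cannot vanish together: if [dot s v] is 0, then [w] is [v] and the first is
   positive; otherwise the second is. *)
have [sv|sv] := eqVneq (dot s v) 0.
  by rewrite sv mul0r scale0r subr0 expr0n/= mul0r addr0 H_gt0.
rewrite ltr_wpDl//; last by rewrite divr_gt0// exprn_even_gt0.
set w := v - _; have [->|/H_gt0/ltW//] := eqVneq w 0.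
by rewrite mulmx0 /dot mulmx0 mxE.
Qed.

End BFGSUpdate.

(** * Positive definiteness and descent along a run *)

Section BFGSRun.
Context {R : realType} {d : nat}.
Variables (phi f : 'cV[R]_d -> R) (g : 'cV[R]_d -> 'cV[R]_d).
Variables (m eps_g c1 c2 l : R) (x0 : 'cV[R]_d) (H0 : 'M[R]_d).
Variables (x p s y : nat -> 'cV[R]_d) (H : nat -> 'M[R]_d) (alpha : nat -> R).
Hypothesis m_gt0 : 0 < m.
Hypothesis diff_phi : forall z, differentiable phi z.
Hypothesis convex_phi : strongly_convex m phi.
Hypothesis g_error : forall z, enorm (g z - gradient phi z) <= eps_g.
Hypothesis c1_ge0 : 0 <= c1.
Hypothesis l_gt0 : 0 < l.
Hypothesis l_large : 2 * eps_g / m < l.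
Hypothesis H0_spd : spd H0.
Hypothesis run : bfgs_with_errors f g c1 c2 l x0 H0 x p s y H alpha.

Lemma enorm_lengthened_step (u : 'cV[R]_d) a :
  u != 0 -> l <= enorm (lengthened_step l u a).
Proof.
move=> u0; rewrite /lengthened_step; case: ifP => // _.
rewrite enormZ ger0_norm ?divr_ge0 ?enorm_ge0 ?(ltW l_gt0)//.
by rewrite divfK ?enorm_eq0.
Qed.

(* Each of the two gradient errors costs at most [eps_g * enorm v], which the
   curvature [m * enorm v ^+ 2] outweighs once [enorm v >= l]. *)
Lemma curvature_gt0 (z v : 'cV[R]_d) :
  l <= enorm v -> 0 < dot v (g (z + v) - g z).
Proof.
move=> lv; have v_gt0 := lt_le_trans l_gt0 lv.
have := strongly_monotone_gradient diff_phi convex_phi z (z + v).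
rewrite addrAC subrr add0r; set G := gradient phi.
have err (w : 'cV[R]_d) a : enorm w <= a -> - (enorm v * a) <= dot v w.
  move=> wa; have := dot_le_enorm v (- w); rewrite dotNr enormN => CS.
  by rewrite lerNl; apply: le_trans CS _; rewrite ler_pM2l.
have := err _ _ (g_error (z + v)).
have := err (G z - g z) eps_g; rewrite -opprB enormN => /(_ (g_error z)).
rewrite opprB -/G !dotBr => h1 h2 h3.
have h4 : 2 * eps_g < m * enorm v.
  by rewrite -ltr_pdivrMl// mulrC (lt_le_trans l_large).
have : 0 < enorm v * (m * enorm v - 2 * eps_g) by rewrite mulr_gt0// subr_gt0.
lra.
Qed.

(** This guarantees that the rescaled step has length [l]; at [p k = 0] it would be the zero
    vector. *)
Lemma search_direction_neq0 k : spd (H k) -> p k != 0.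
Proof.
move=> [_ /(_ _ (bfgs_g_neq0 run k))]; apply: contraTneq => pk0.
rewrite (_ : H k *m g (x k) = 0) ?/dot ?mulmx0 ?mxE ?ltxx//.
by apply/eqP; rewrite -oppr_eq0 -(bfgs_p run) pk0.
Qed.

(** Induction: [H k] positive definite makes [p k] nonzero, so the step has length at least [l], the
    curvature is positive, and the update stays positive definite. *)
Lemma bfgs_spd k : spd (H k).
Proof.
elim: k => [|k IHk]; first by rewrite (bfgs_H0 run).
rewrite (bfgs_H run); apply: bfgs_update_spd => //.
rewrite (bfgs_y run) curvature_gt0// (bfgs_s run).
by rewrite enorm_lengthened_step// search_direction_neq0.
Qed.

(** A failed search leaves the iterate in place; a successful one satisfies Armijo with slope
    [- dot g (H g) < 0]. *)
Lemma bfgs_nonincreasing : nonincreasing_seq (f \o x).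
Proof.
apply/nonincreasing_seqP => k /=; rewrite (bfgs_x run).
have [[a0 [dec _]]|->] := bfgs_alpha run k; last by rewrite scale0r addr0.
apply: le_trans dec _; rewrite gerDl mulr_ge0_le0 ?mulr_ge0 ?(ltW a0)// ltW//.
rewrite (bfgs_p run) dotC dotNr oppr_lt0.
exact: (bfgs_spd k).2 (bfgs_g_neq0 run k).
Qed.

End BFGSRun.

(** * Entry into [N1] and the bound afterwards *)

Lemma first_entry_le (R : realType) (d : nat) (x : nat -> 'cV[R]_d)
    (S : set 'cV[R]_d) k :
  (first_entry x S <= (k%:R)%:E)%E -> exists2 n, (n <= k)%N & S (x n).
Proof.
move=> Kk; apply: contrapT => none.
(* With no entry up to [k], [k.+1] is a lower bound of the entry indices, even when there are none
   and the infimum is [+oo]. *)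
have : ((k.+1%:R)%:E <= first_entry x S)%E.
  apply: le_ereal_inf_tmp => _ [n Sn <-]; rewrite lee_fin ler_nat ltnNge.
  by apply/negP => nk; apply: none; exists n.
by move=> /le_trans /(_ Kk); rewrite lee_fin ler_nat ltnn.
Qed.

Theorem theorem3p18 (R : realType) (d : nat)
  (phi f : 'cV[R]_d -> R) (g : 'cV[R]_d -> 'cV[R]_d)
  (m M eps_f eps_g c1 c2 l q : R)
  (x0 : 'cV[R]_d) (H0 : 'M[R]_d)
  (x p s y : nat -> 'cV[R]_d) (H : nat -> 'M[R]_d) (alpha : nat -> R)
  (phi_bounded_below : bounded_below phi)
  (phi_C2 : twice_cont_diff phi)
  (M_gt0 : 0 < M)
  (phi_lipschitz : lipschitz_gradient M phi)
  (m_gt0 : 0 < m)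
  (m_le_M : m <= M)
  (phi_convex : strongly_convex m phi)
  (eps_f_ge0 : 0 <= eps_f)
  (eps_g_ge0 : 0 <= eps_g)
  (f_error : forall z, `|f z - phi z| <= eps_f)
  (g_error : forall z, enorm (g z - gradient phi z) <= eps_g)
  (c1_gt0 : 0 < c1)
  (c1_lt_c2 : c1 < c2)
  (c2_lt1 : c2 < 1)
  (l_gt0 : 0 < l)
  (l_large : 2 * eps_g / m < l)
  (H0_spd : spd H0)
  (run : bfgs_with_errors f g c1 c2 l x0 H0 x p s y H alpha)
  (q_gt0 : 0 < q)
  (q_lt1 : q < 1) :
  let N_1 := N1 phi m M eps_f eps_g c1 c2 l q H0 in
  let K := first_entry x N_1 in
  exists2 phi_hat : R, is_max (phi @` N_1) phi_hat &
    forall k : nat, (K <= (k%:R)%:E)%E -> N2 phi phi_hat eps_f (x k).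
Proof.
move=> N_1 K; have [diff_phi diff_grad _] := phi_C2.
set b1 := beta1 m M eps_g l q H0.
pose r := Num.max (constA c1 c2 * (Num.sqrt (M * eps_f) / b1))
                  (constB c1 c2 * (eps_g / b1)).
(* A nonnegative threshold puts the critical point in [N_1] and makes the radius below
   nonnegative. *)
have r_ge0 : 0 <= r.
  rewrite le_max; apply/orP; left.
  rewrite mulr_ge0 ?divr_ge0 ?sqrtr_ge0 ?expR_ge0//.
  by rewrite le_max divr_ge0 ?mulr_ge0 ?sqrtr_ge0.
have [z0 grad0] := strongly_convex_critical_point m_gt0 diff_phi phi_convex.
have N1_z0 : N_1 z0.
  by rewrite /N_1/N1/= grad0 -(scale0r 0) enormZ normr0 mul0r.
have compact_N1 : compact N_1.
  (* Strong monotonicity between 0 and [z] gives [m * enorm z ^+ 2 <= enorm z * (r + enorm (gradient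
     phi 0))]. *)
  apply: (@enorm_bounded_closed_compact _ _ _ ((r + enorm (gradient phi 0)) / m)).
    by apply: closed_enorm_le => z; exact: differentiable_continuous.
  move=> z zr; have {}zr : enorm (gradient phi z) <= r by [].
  have := strongly_monotone_gradient diff_phi phi_convex 0 z.
  rewrite subr0 dotDr; have := dot_le_enorm z (gradient phi z).
  have := dot_le_enorm z (- gradient phi 0); rewrite enormN.
  have := enorm_ge0 z; rewrite le_eqVlt => /predU1P[<- _ _ _|z_gt0 CS0 CSz mono].
    by rewrite divr_ge0 ?addr_ge0 ?enorm_ge0 ?(ltW m_gt0).
  have : enorm z * enorm (gradient phi z) <= enorm z * r by rewrite ler_pM2l.
  move=> grad_r; rewrite ler_pdivlMr// -(ler_pM2r z_gt0); lra.
have cphi : continuous phi by move=> z; exact: differentiable_continuous.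
have [c cN1 cmax] := compact_EVT_max (ex_intro _ z0 N1_z0) compact_N1
  (continuous_subspaceT cphi).
exists (phi c).
  split; first by exists c => //; rewrite inE in cN1.
  by move=> _ [z zN1 <-]; apply: cmax; rewrite inE.
(* Any entry index [n <= k] serves: [phi (x k) <= f (x k) + eps_f <= f (x n) + eps_f <= phi (x n) +
   2 * eps_f], and [phi (x n) <= phi c]. *)
move=> k /first_entry_le[n nk xnN1]; rewrite /N2/=.
have : phi (x n) <= phi c by apply: cmax; rewrite inE.
have /= := bfgs_nonincreasing m_gt0 diff_phi phi_convex g_error (ltW c1_gt0) l_gt0
  l_large H0_spd run nk.
have := f_error (x k); have := f_error (x n).
by rewrite !ler_distl => /andP[_ fn] /andP[fk _]; lra.
Qed.
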